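(* Problem 2 is a convex relaxation of Problem 1. That is: (i) every feasible solution of Problem 1 is feasible for Problem 2, i.e. if control parameters $\alpha_i^{(k)}(t)\in[0,1]$ and $(x(t),z(t),f(t))$, $t\in[0,T]$, satisfy the constraints of Problem 1, then $(\bar x,\bar z,\bar f)=(x,z,f)$ satisfies the constraints of Problem 2; and (ii) Problem 2 is a convex optimal control problem, i.e. its set of feasible $(\bar x,\bar z,\bar f)$ is convex and its objective functional $\int_0^T\varphi(\bar x(t),\bar z(t))\,dt$ is convex.
   Context: **Network.** $\mathcal{G}=(\mathcal{V},\mathcal{E})$ is a nonempty finite directed multigraph; its links are called cells. Cell $i$ is directed from its tail node $\tau_i$ to its head node $\sigma_i$. $\mathcal{R},\mathcal{S}\subset\mathcal{E}$ are the sets of onramps and offramps, with $\mathcal{R}\cap\mathcal{S}=\emptyset$. $\mathcal{A}=\{(i,j)\in\mathcal{E}\times\mathcal{E}:\sigma_i=\tau_j\}$ is the set of adjacent (consecutive) cell pairs. $\mathcal{K}$ is a finite set of commodities. The state is $x=(x_i^{(k)})\in\mathbb{R}_+^{\mathcal{E}\times\mathcal{K}}$, where $x_i^{(k)}$ is the traffic volume of commodity $k$ in cell $i$; $x^0\in\mathbb{R}_+^{\mathcal{E}\times\mathcal{K}}$ is a given initial state. **Demand and supply.** For all $i\in\mathcal{E}$, $k\in\mathcal{K}$, the demand function $d_i^{(k)}:\mathbb{R}_+\to\mathbb{R}_+$ is Lipschitz-continuous, concave, non-decreasing, with $d_i^{(k)}(0)=0$. For all $i\in\mathcal{E}$, the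 supply function $s_i:\mathbb{R}_+\to\mathbb{R}_+$ is Lipschitz-continuous, concave and non-increasing; it is evaluated at $\sum_{k\in\mathcal{K}}w_i^{(k)}x_i^{(k)}$, where $w_i^{(k)}>0$ are given weights. **Inflows and routing.** The exogenous inflows satisfy $\lambda_i^{(k)}(t)\ge0$, with $\lambda_i^{(k)}\equiv0$ for $i\in\mathcal{E}\setminus\mathcal{R}$. The routing matrices $R^{(k)}(t)\in\mathbb{R}_+^{\mathcal{E}\times\mathcal{E}}$ have entries in $[0,1]$ and satisfy, for all $t\geq 0$ and $k\in\mathcal{K}$: $\sum_{j\in\mathcal{E}}R_{ij}^{(k)}(t)=1$ if $i\in\mathcal{E}\setminus\mathcal{S}$ and $=0$ if $i\in\mathcal{S}$; and $R_{ij}^{(k)}(t)=0$ whenever $(i,j)\notin\mathcal{A}$. **C-DMFN.** Given control parameters $\alpha_i^{(k)}(t)\in[0,1]$, the Controlled Dynamical Multi-Commodity Flow Network (C-DMFN) is the dynamical system defined, for all $i,j\in\mathcal{E}$, $k\in\mathcal{K}$, by (E1) $\dot x_i^{(k)}(t)=\lambda_i^{(k)}(t)+\sum_{j\in\mathcal{E}}f_{ji}^{(k)}-z_i^{(k)}$; (E2) $z_i^{(k)}=\sum_{j\in\mathcal{E}}f_{ij}^{(k)}$ if $i\in\mathcal{E}\setminus\mathcal{S}$, and $z_i^{(k)}=\alpha_i^{(k)}d_i^{(k)}(x_i^{(k)})$ if $i\in\mathcal{S}$; (E3) $f_{ij}^{(k)}=\gamma_i^F\,R_{ij}^{(k)}(t)\,\alpha_i^{(k)}(t)\,d_i^{(k)}(x_i^{(k)})$;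 (E4) $\gamma_i^F$ is the largest $\gamma\in[0,1]$ such that, for every $j\in\mathcal{E}$ with $R_{ij}^{(k)}(t)>0$ for some $k\in\mathcal{K}$, $$\gamma\sum_{k\in\mathcal{K}}\sum_{h\in\mathcal{E}}R_{hj}^{(k)}(t)\alpha_h^{(k)}(t)d_h^{(k)}(x_h^{(k)})\le s_j\Big(\sum_{k\in\mathcal{K}}w_j^{(k)}x_j^{(k)}\Big).$$ **Cost.** $\varphi(x,z)$ is convex and differentiable in $(x,z)$, non-decreasing in $x$ ($\partial\varphi/\partial x\ge0$), non-increasing in $z$ ($\partial\varphi/\partial z\le0$), and $\varphi(0,0)=0$. $T>0$ is a finite horizon. **Problem 1.** Minimize $\int_0^T\varphi(x(t),z(t))\,dt$ over control parameters $\alpha_i^{(k)}(t)\in[0,1]$, $i\in\mathcal{E}$, $k\in\mathcal{K}$, $t\in[0,T]$, subject to (E1)--(E4) and $x(0)=x^0$. **Problem 2.** Minimize $\int_0^T\varphi(\bar x(t),\bar z(t))\,dt$ over non-negative time-dependent variables $\bar x(t)\in\mathbb{R}_+^{\mathcal{E}\times\mathcal{K}}$, $\bar z(t)\in\mathbb{R}_+^{\mathcal{E}\times\mathcal{K}}$, $\bar f(t)\in\mathbb{R}_+^{\mathcal{A}\times\mathcal{K}}$ (with $\bar f_{ij}^{(k)}:=0$ for $(i,j)\notin\mathcal{A}$), subject to, for all $t\in[0,T]$, $i\in\mathcal{E}$, $k\in\mathcal{K}$: - $\dot{\bar x}_i^{(k)}(t)=\lambda_i^{(k)}(t)+\sum_{j\in\mathcal{E}}\bar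 f_{ji}^{(k)}(t)-\bar z_i^{(k)}(t)$; - $\bar z_i^{(k)}(t)\le d_i^{(k)}(\bar x_i^{(k)}(t))$; - $\sum_{k\in\mathcal{K}}\sum_{j\in\mathcal{E}}\bar f_{ji}^{(k)}(t)\le s_i\big(\sum_{k\in\mathcal{K}}w_i^{(k)}\bar x_i^{(k)}(t)\big)$; - $\bar f_{ij}^{(k)}(t)=R_{ij}^{(k)}(t)\bar z_i^{(k)}(t)$ for all $(i,j)\in\mathcal{A}$; - $\bar x(0)=x^0$. *)

(* Defs.v *)
From HB Require Import structures.
From mathcomp Require Import all_boot all_order all_algebra.
From mathcomp Require Import all_classical all_reals all_analysis.

Set Implicit Arguments.
Unset Strict Implicit.
Unset Printing Implicit Defensive.

Import Order.TTheory GRing.Theory Num.Theory.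
Import numFieldNormedType.Exports.

Local Open Scope classical_set_scope.
Local Open Scope ring_scope.

Definition concave_function (R : realType) (D : set R) (f : R -> R) :=
  convex_function (D : set (convex_lmodType R^o)) (fun v => - f v).

(** Cells are indexed by ['I_n] and commodities by ['I_m].  All functions are
    total in Rocq; the conditions on demands and supplies only concern
    [`[0, +oo[], and those on inflows and routing only times [t >= 0]. *)
Record network (R : realType) (n m : nat) := Network {
  node : finType;
  cell_tail : 'I_n -> node;
  cell_head : 'I_n -> node;
  onramp : {set 'I_n};
  offramp : {set 'I_n};
  demand : 'I_n -> 'I_m -> R -> R;
  supply : 'I_n -> R -> R;
  weight : 'I_n -> 'I_m -> R;
  inflow : R -> 'M[R]_(n, m);
  routing : 'I_m -> R -> 'M[R]_n;
  init_state : 'M[R]_(n, m);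
  node_gt0 : (0 < #|node|)%N;
  ramp_disjoint : onramp :&: offramp = finset.set0;
  demand_ge0 : forall i k v, 0 <= v -> 0 <= demand i k v;
  demand_lipschitz : forall i k, [lipschitz demand i k v | v in `[0, +oo[];
  demand_concave : forall i k, concave_function `[0, +oo[ (demand i k);
  demand_nondecreasing : forall i k v w,
    0 <= v -> v <= w -> demand i k v <= demand i k w;
  demand0 : forall i k, demand i k 0 = 0;
  supply_ge0 : forall i v, 0 <= v -> 0 <= supply i v;
  supply_lipschitz : forall i, [lipschitz supply i v | v in `[0, +oo[];
  supply_concave : forall i, concave_function `[0, +oo[ (supply i);
  supply_nonincreasing : forall i v w,
    0 <= v -> v <= w -> supply i w <= supply i v;
  weight_gt0 : forall i k, 0 < weight i k;
  inflow_ge0 : forall t i k, 0 <= t -> 0 <= inflow t i k;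
  inflow_onramp : forall t i k, 0 <= t -> i \notin onramp -> inflow t i k = 0;
  routing_itv : forall k t i j, 0 <= t -> 0 <= routing k t i j <= 1;
  routing_sum : forall k t i, 0 <= t ->
    \sum_j routing k t i j = if i \in offramp then 0 else 1;
  routing_adjacent : forall k t i j, 0 <= t ->
    cell_head i != cell_tail j -> routing k t i j = 0;
  init_state_ge0 : forall i k, 0 <= init_state i k
}.

Section dynamics.
Context {R : realType} {n m : nat} (N : network R n m).

Definition adjacent (i j : 'I_n) : bool := cell_head N i == cell_tail N j.

(** The argument of the supply function of cell [j] in state [x]. *)
Definition occupancy (x : 'M[R]_(n, m)) (j : 'I_n) : R :=
  \sum_k weight N j k * x j k.

(** The scaling factor [g] of cell [i] scales the whole potential inflow of each
    downstream cell [j], not only the part coming from [i]. *)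
Definition scaling_ok (t : R) (a x : 'M[R]_(n, m)) (i : 'I_n) (g : R) : Prop :=
  forall j : 'I_n, (exists k, 0 < routing N k t i j) ->
    g * (\sum_k \sum_h routing N k t h j * a h k * demand N h k (x h k))
      <= supply N j (occupancy x j).

Definition is_scaling_factor (t : R) (a x : 'M[R]_(n, m)) (i : 'I_n) (g : R) :
    Prop :=
  [/\ 0 <= g <= 1, scaling_ok t a x i g
    & forall g', 0 <= g' <= 1 -> scaling_ok t a x i g' -> g' <= g].

(** Derivative relative to [[0, T]]: the usual one inside, one-sided at the
    endpoints. *)
Definition has_derivative_on (T : R) (y : R -> R) (t l : R) : Prop :=
  (s - t)^-1 * (y s - y t) @[s --> within `[0, T] t^'] --> l.

Definition absolutely_continuous_on (T : R) (y : R -> R) : Prop :=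
  forall e, 0 < e -> exists2 d, 0 < d &
    forall (p : nat) (u v : nat -> R),
      (forall q, (q < p)%N -> [/\ 0 <= u q, u q <= v q & v q <= T]) ->
      (forall q, (q.+1 < p)%N -> v q <= u q.+1) ->
      \sum_(q < p) (v q - u q) < d ->
      \sum_(q < p) `|y (v q) - y (u q)| < e.

(** Two standard meanings of [y' = F] on [[0, T]]: the equation holds at every
    time, or [y] is absolutely continuous and it holds at almost every time
    (as needed for discontinuous controls). *)
Variant solution_concept := Classical | Caratheodory.

Definition solves (c : solution_concept) (T : R) (y F : R -> R) : Prop :=
  match c with
  | Classical => forall t, 0 <= t <= T -> has_derivative_on T y t (F t)
  | Caratheodory => absolutely_continuous_on T y /\
      {ae @lebesgue_measure R,
        forall t, 0 <= t <= T -> has_derivative_on T y t (F t)}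
  end.

(** [((x, z), f)], with [f t k i j] the flow of commodity [k] from cell [i] to
    cell [j]; only the values at times in [[0, T]] are constrained. *)
Definition trajectory : Type :=
  (R -> 'M[R]_(n, m)) * (R -> 'M[R]_(n, m)) * (R -> 'I_m -> 'M[R]_n).

Definition mass_balance (c : solution_concept) (T : R) (p : trajectory) : Prop :=
  let: (x, z, f) := p in
  forall i k, solves c T (fun t => x t i k)
    (fun t => inflow N t i k + \sum_j f t k j i - z t i k).

(** Together with the continuity of [x], this makes the integrand of the cost
    measurable. *)
Definition measurable_outflow (T : R) (z : R -> 'M[R]_(n, m)) : Prop :=
  forall i k, measurable_fun `[0, T] (fun t => z t i k).

Definition feasible1 (c : solution_concept) (T : R) (a : R -> 'M[R]_(n, m)) :
    set trajectory :=
  [set p : trajectory | let: (x, z, f) := p in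
    [/\ (forall t i k, 0 <= t <= T -> 0 <= a t i k <= 1),
        (forall t i k, 0 <= t <= T -> 0 <= x t i k) /\ measurable_outflow T z,
        mass_balance c T p,
        (exists g : R -> 'I_n -> R, forall t, 0 <= t <= T ->
          [/\ (forall i, is_scaling_factor t (a t) (x t) i (g t i)),
              (forall i j k, f t k i j =
                 g t i * routing N k t i j * a t i k * demand N i k (x t i k))
            & (forall i k, z t i k =
                 if i \in offramp N then a t i k * demand N i k (x t i k)
                 else \sum_j f t k i j)])
      & x 0 = init_state N]].

Definition feasible2 (c : solution_concept) (T : R) : set trajectory :=
  [set p : trajectory | let: (x, z, f) := p in
    [/\ (forall t i k, 0 <= t <= T -> 0 <= x t i k /\ 0 <= z t i k) /\
          measurable_outflow T z,
        (forall t i j k, 0 <= t <= T -> 0 <= f t k i j /\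
          (~~ adjacent i j -> f t k i j = 0)),
        mass_balance c T p,
        (forall t, 0 <= t <= T ->
          [/\ (forall i k, z t i k <= demand N i k (x t i k)),
              (forall i, \sum_k \sum_j f t k j i <=
                 supply N i (occupancy (x t) i))
            & (forall i j k, adjacent i j ->
                 f t k i j = routing N k t i j * z t i k)])
      & x 0 = init_state N]].

End dynamics.

Section cost.
Context {R : realType} {n m : nat}.
Implicit Type phi : 'M[R]_(n, m) * 'M[R]_(n, m) -> R.

Definition orthant : set ('M[R]_(n, m) * 'M[R]_(n, m)) :=
  [set p : 'M[R]_(n, m) * 'M[R]_(n, m) |
     forall i k, 0 <= p.1 i k /\ 0 <= p.2 i k].

(** Differentiability and the partial derivatives are the two-sided ones, also
    at boundary points of the orthant; away from it [phi] is unconstrained. *)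
Definition admissible_cost phi : Prop :=
  [/\ convex_function (orthant : set (convex_lmodType _)) phi,
      (forall p, orthant p -> differentiable phi p),
      (forall p i k, orthant p -> 0 <= 'D_(delta_mx i k, 0) phi p),
      (forall p i k, orthant p -> 'D_(0, delta_mx i k) phi p <= 0)
    & phi (0, 0) = 0].

Definition running_cost phi (p : @trajectory R n m) : R -> R :=
  fun t => phi (p.1.1 t, p.1.2 t).

Definition total_cost phi (T : R) (p : @trajectory R n m) : R :=
  \int[@lebesgue_measure R]_(t in `[0, T]) running_cost phi p t.

End cost.

(* Main.v *)
Require Import Defs.
From mathcomp Require Import all_boot all_order all_algebra.
From mathcomp Require Import all_classical all_reals all_analysis.
From mathcomp Require Import measurable_realfun lra.

(** Relaxation.  In the controlled network the scaling factor [g_i] multiplies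
    all the outflow of cell [i], so [f_ij = R_ij z_i] holds with [z_i] at most
    the demand of [i].  The supply bound of cell [j] holds because every
    upstream factor is at most the largest one, and the defining inequality of
    that largest factor already bounds the whole scaled potential inflow of [j]
    ([scaled_inflow_le_supply]).

    Convexity of the feasible set.  All the constraints of the relaxed problem
    are affine except the demand and supply bounds, whose right-hand sides are
    concave.  The mass balance is affine for both meanings of a solution, since
    derivatives relative to [[0, T]] and absolute continuity survive linear
    combinations ([solves_lincomb], [feasible2_lincomb]).

    Convexity of the objective.  The running cost is convex pointwise, so only
    its integrability is at stake: the integral is linear and monotone on
    integrable functions.
    - It is bounded: a solution is continuous, so the state stays below some
      [B] and the outflow below the demand [Z] at [B].  The gradient inequality
      of a convex function turns the signs of the partial derivatives of [phi]
      into monotonicity ([admissible_cost_monotone]), whence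
      [phi (0, Z) <= phi (x, z) <= phi (B, 0)].
    - It is measurable: [phi] is only known to be continuous at the points of
      the orthant, but this is enough to write [phi (x, z)] as the pointwise
      limit of its values at points rounded to finer and finer grids, each of
      which takes countably many values on measurable sets
      ([measurable_fun_comp_matrix]). *)

Set Implicit Arguments.
Unset Strict Implicit.
Unset Printing Implicit Defensive.

Import Order.TTheory GRing.Theory Num.Theory.
Import numFieldNormedType.Exports.

Local Open Scope classical_set_scope.
Local Open Scope ring_scope.
Local Open Scope convex_scope.

(** * The relaxation *)

Section relaxation.
Context {R : realType} {n m : nat} (N : network R n m).

Lemma routing_ge0 k t i j : 0 <= t -> 0 <= routing N k t i j.
Proof. by move=> t0; case/andP: (routing_itv N k i j t0). Qed.

Lemma routing_offramp k t i j :
  0 <= t -> i \in offramp N -> routing N k t i j = 0.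
Proof.
move=> t0 iS; have := routing_sum N k i t0; rewrite iS => /eqP.
rewrite psumr_eq0 => [/allP/(_ j)|j' _]; last exact: routing_ge0.
by rewrite mem_index_enum => /(_ isT)/eqP.
Qed.

Lemma occupancy_ge0 (x : 'M[R]_(n, m)) j :
  (forall k, 0 <= x j k) -> 0 <= occupancy N x j.
Proof.
by move=> x0; apply: sumr_ge0 => k _; rewrite mulr_ge0 // ltW ?weight_gt0.
Qed.

(** If [g_j] is largest among the cells upstream of [i], its defining
    inequality bounds [g_j] times the potential inflow of [i] from all cells,
    which dominates the actual inflow term by term. *)
Lemma scaled_inflow_le_supply t (a x : 'M[R]_(n, m)) (g : 'I_n -> R) i :
    0 <= t -> (forall j k, 0 <= a j k) -> (forall j k, 0 <= x j k) ->
    (forall j, scaling_ok N t a x j (g j)) ->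
  \sum_k \sum_j g j * routing N k t j i * a j k * demand N j k (x j k)
    <= supply N i (occupancy N x i).
Proof.
move=> t0 a0 x0 gok.
have pot0 k h : 0 <= routing N k t h i * a h k * demand N h k (x h k).
  by rewrite !mulr_ge0 ?routing_ge0 ?demand_ge0.
have s0 : 0 <= supply N i (occupancy N x i).
  by apply: supply_ge0; exact: occupancy_ge0.
have [j0 Pj0|noup] :=
  pickP [pred j | [exists k, 0 < routing N k t j i]]; last first.
  (* Without an upstream cell there is no inflow at all. *)
  rewrite big1 // => k _; rewrite big1 // => j _.
  suff -> : routing N k t j i = 0 by rewrite mulr0 !mul0r.
  apply/eqP; rewrite eq_le routing_ge0 // andbT leNgt.
  by have /existsPn/(_ k) := negbT (noup j).
have [j /existsP[kj Rj] gmax] := arg_maxP g Pj0.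
apply: le_trans (gok j i _); last by exists kj.
rewrite mulr_sumr ler_sum // => k _; rewrite mulr_sumr ler_sum // => h _.
have -> : g h * routing N k t h i * a h k * demand N h k (x h k) =
    g h * (routing N k t h i * a h k * demand N h k (x h k)) by rewrite !mulrA.
have [Rh|] := ltP 0 (routing N k t h i).
  by apply: ler_wpM2r; rewrite ?pot0 //; apply: gmax; apply/existsP; exists k.
move=> Rle; have -> : routing N k t h i = 0.
  by apply/eqP; rewrite eq_le Rle routing_ge0.
by rewrite !mul0r !mulr0.
Qed.

(** Writing [z_i = g_i a_i d_i] off the offramps makes both [z_i <= d_i] and
    [f_ij = R_ij z_i] immediate; at an offramp the routing row vanishes, so that
    both sides of the latter are zero. *)
Lemma feasible1_sub_feasible2 c (T : R) (a : R -> 'M[R]_(n, m)) :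
  feasible1 N c T a `<=` feasible2 N c T.
Proof.
move=> [[x z] f] /= [a01 [x0 mz] mb [g gP] xinit].
have eqs t : 0 <= t <= T -> forall i k,
    (forall j, f t k i j = routing N k t i j * z t i k) /\
    0 <= z t i k <= demand N i k (x t i k).
  move=> tT i k; have t0 : 0 <= t by case/andP: tT.
  have [gs fE zE] := gP t tT; have [/andP[g0 g1] _ _] := gs i.
  have /andP[a0 a1] := a01 t i k tT.
  have d0 := demand_ge0 N i k (x0 t i k tT).
  rewrite zE; case: ifPn => iS; last first.
    have -> : \sum_j f t k i j = g t i * (a t i k * demand N i k (x t i k)).
      under eq_bigr do rewrite fE.
      rewrite -!big_distrl -big_distrr /= routing_sum // (negbTE iS).
      by rewrite mulr1 mulrA.
    split=> [j|]; first by rewrite fE -!mulrA mulrCA.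
    by rewrite !mulr_ge0 //= mulrA ler_piMl // mulr_ile1.
  split=> [j|]; first by rewrite fE routing_offramp // !(mul0r, mulr0).
  by rewrite mulr_ge0 //= ler_piMl.
split => //.
- split => // t i k tT; split; first exact: x0.
  by have [_ /andP[]] := eqs t tT i k.
- move=> t i j k tT; have t0 : 0 <= t by case/andP: tT.
  have [fE /andP[z0 _]] := eqs t tT i k.
  rewrite fE mulr_ge0 ?routing_ge0 //; split=> // nadj.
  by rewrite routing_adjacent ?mul0r.
- move=> t tT; have t0 : 0 <= t by case/andP: tT.
  split=> [i k|i|i j k _].
  + by have [_ /andP[]] := eqs t tT i k.
  + have [gs fE _] := gP t tT.
    under eq_bigr => k _ do under eq_bigr do rewrite fE.
    apply: scaled_inflow_le_supply => // [j k|j k|j].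
    * by have /andP[] := a01 t j k tT.
    * exact: x0.
    * by have [] := gs j.
  + by have [-> _] := eqs t tT i k.
Qed.

End relaxation.

(** * Solutions of the mass balance *)

Section solutions.
Context {R : realType}.
Implicit Types (T a b t l : R) (y z F G : R -> R).

Lemma has_derivative_on_lincomb T a b y z t l l' :
    has_derivative_on T y t l -> has_derivative_on T z t l' ->
  has_derivative_on T (fun s => a * y s + b * z s) t (a * l + b * l').
Proof.
move=> Hy Hz; rewrite /has_derivative_on.
have -> : (fun s => (s - t)^-1 * (a * y s + b * z s - (a * y t + b * z t))) =
    (fun s => a * ((s - t)^-1 * (y s - y t)) + b * ((s - t)^-1 * (z s - z t))).
  by apply/funext => s; lra.
by apply: cvgD; apply: cvgM => //; exact: cvg_cst.
Qed.

Lemma absolutely_continuous_on_lincomb T a b y z :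
    absolutely_continuous_on T y -> absolutely_continuous_on T z ->
  absolutely_continuous_on T (fun s => a * y s + b * z s).
Proof.
(* The summand 1 makes [M] positive and the final inequality strict. *)
move=> Hy Hz e e0; set M := `|a| + `|b| + 1.
have M0 : 0 < M by rewrite ltr_wpDl // addr_ge0.
have eM0 : 0 < e / M by rewrite divr_gt0.
have [d d0 Hd] := Hy _ eM0; have [d' d'0 Hd'] := Hz _ eM0.
exists (Num.min d d'); first by rewrite lt_min d0.
move=> p u v uv vu; rewrite lt_min => /andP[sd sd'].
have Sy := Hd p u v uv vu sd; have Sz := Hd' p u v uv vu sd'.
apply: (@le_lt_trans _ _ (`|a| * (e / M) + `|b| * (e / M))); last first.
  by rewrite -mulrDl mulrCA gtr_pMr // ltr_pdivrMr // mul1r ltrDl.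
apply: le_trans (lerD (ler_wpM2l (normr_ge0 a) (ltW Sy))
                      (ler_wpM2l (normr_ge0 b) (ltW Sz))).
rewrite !mulr_sumr -big_split /= ler_sum // => q _.
rewrite -!normrM.
have -> : a * y (v q) + b * z (v q) - (a * y (u q) + b * z (u q)) =
    a * (y (v q) - y (u q)) + b * (z (v q) - z (u q)) by lra.
exact: ler_normD.
Qed.

Lemma solves_lincomb c T a b y z F G :
    solves c T y F -> solves c T z G ->
  solves c T (fun s => a * y s + b * z s) (fun s => a * F s + b * G s).
Proof.
case: c => /= [Hy Hz t tT|[ACy Hy] [ACz Hz]].
  by apply: has_derivative_on_lincomb; [exact: Hy|exact: Hz].
split; first exact: absolutely_continuous_on_lincomb.
have aeF : Filter (almost_everywhere (@lebesgue_measure R)).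
  exact: ae_filter_ringOfSetsType.
apply: (@filterS2 _ _ aeF _ _ _ _ Hy Hz) => t {}Hy {}Hz tT.
by apply: has_derivative_on_lincomb; [exact: Hy|exact: Hz].
Qed.

(** Near [t] the slopes are bounded by [`|l| + 1], so [y] is Lipschitz at
    [t]. *)
Lemma has_derivative_on_continuous_at T y t l : has_derivative_on T y t l ->
  y s @[s --> within `[0, T] (nbhs t)] --> y t.
Proof.
move=> Hy; apply/cvgrPdist_lt => e e0.
have M0 : 0 < `|l| + 1 by rewrite ltr_wpDl.
have near_t : \forall s \near t, `|t - s| < e / (`|l| + 1).
  by apply: nbhsx_ballx; rewrite divr_gt0.
move: Hy => /cvgrPdistC_lt /(_ _ ltr01) slope.
have {}slope : \forall s \near t, s != t -> `[0, T]%classic s ->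
    `|(s - t)^-1 * (y s - y t) - l| < 1 by exact: slope.
suff : \forall s \near t, `[0, T]%classic s -> `|y t - y s| < e by [].
apply: filterS2 slope near_t => s slope st sT.
have [->|st_neq] := eqVneq s t; first by rewrite subrr normr0.
have st0 : s - t != 0 by rewrite subr_eq0.
have slope_bound : `|(s - t)^-1 * (y s - y t)| < `|l| + 1.
  rewrite -ltrBlDl; apply: le_lt_trans (slope st_neq sT).
  exact: lerB_dist.
have -> : y t - y s = (t - s) * ((s - t)^-1 * (y s - y t)).
  by rewrite -(opprB s t) mulNr mulVKf // opprB.
rewrite normrM; move: st; rewrite ltr_pdivlMr //.
by apply: le_lt_trans; rewrite ler_wpM2l // ltW.
Qed.

Lemma absolutely_continuous_on_continuous T y : absolutely_continuous_on T y ->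
  {within `[0, T], continuous y}.
Proof.
move=> Hy; apply/subspace_continuousP => t /=; rewrite in_itv /=.
move=> /andP[t0 tT].
apply/cvgrPdist_lt => e e0; have [d d0 Hd] := Hy _ e0.
suff : \forall s \near t, `[0, T]%classic s -> `|y t - y s| < e by [].
apply: filterS (nbhsx_ballx t d d0) => s ts.
rewrite /= in_itv /= => /andP[s0 sT].
(* A single interval suffices for continuity. *)
have incr u v : 0 <= u -> u <= v -> v <= T -> v - u < d -> `|y v - y u| < e.
  move=> u0 uv vT vu; have := Hd 1%N (fun=> u) (fun=> v).
  by rewrite !big_ord1; apply.
move: ts; rewrite /ball /=; have [st|/ltW ts] := leP s t.
  by rewrite ger0_norm ?subr_ge0 //; exact: incr.
by rewrite distrC (distrC (y t)) ger0_norm ?subr_ge0 //; exact: incr.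
Qed.

Lemma solves_continuous c T y F : solves c T y F ->
  {within `[0, T], continuous y}.
Proof.
case: c => /= [Hy|[Hy _]]; last exact: absolutely_continuous_on_continuous.
apply/subspace_continuousP => t; rewrite /= in_itv /= => tT.
exact: has_derivative_on_continuous_at (Hy t tT).
Qed.

End solutions.

(** * Convexity of the relaxed feasible set *)

Section convexity.
Context {R : realType} {n m : nat} (N : network R n m).

(** Jensen's inequality with the two weights given separately, which avoids
    the packed unit-interval type. *)
Lemma concave_function_lincomb (D : set R) (f : R -> R) (u v a b : R) :
    concave_function D f -> D u -> D v -> 0 <= a -> 0 <= b -> a + b = 1 ->
  a * f u + b * f v <= f (a * u + b * v).
Proof.
move=> cf Du Dv a0 b0 ab.
have a01 : Itv.spec (@Itv.num_sem R) (Itv.Real `[0, 1]%Z) a.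
  by rewrite /= /Itv.num_sem /= ger0_real // in_itv /= a0 -ab lerDl.
have := cf (Itv.mk a01) u v (mem_set Du) (mem_set Dv).
rewrite convRE /=; have -> : (u : convex_lmodType R^o) <| Itv.mk a01 |> v =
  a * u + unstable.onem a * v by [].
have -> : unstable.onem a = b by rewrite /unstable.onem -ab; lra.
lra.
Qed.

Lemma occupancy_lincomb (a b : R) (x y : 'M[R]_(n, m)) j :
  occupancy N (a *: x + b *: y) j = a * occupancy N x j + b * occupancy N y j.
Proof.
rewrite /occupancy !mulr_sumr -big_split; apply: eq_bigr => k _ /=.
by rewrite !mxE mulrDr !(mulrCA (weight _ _ _)).
Qed.

Lemma feasible2_lincomb c (T a b : R) (x z y w : R -> 'M[R]_(n, m))
    (f g : R -> 'I_m -> 'M[R]_n) :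
    0 <= a -> 0 <= b -> a + b = 1 ->
    feasible2 N c T (x, z, f) -> feasible2 N c T (y, w, g) ->
  feasible2 N c T (fun t => a *: x t + b *: y t, fun t => a *: z t + b *: w t,
                   fun t k => a *: f t k + b *: g t k).
Proof.
move=> a0 b0 ab [[xz0 mz] f0 mbx Cx xinit] [[yw0 mw] g0 mby Cy yinit].
have nonneg u v : 0 <= u -> 0 <= v -> 0 <= a * u + b * v.
  by move=> u0 v0; rewrite addr_ge0 ?mulr_ge0.
split.
- split=> [t i k tT|i k].
    have [x0 z0] := xz0 t i k tT; have [y0 w0] := yw0 t i k tT.
    by rewrite !mxE; split; exact: nonneg.
  rewrite (_ : (fun t => _) = (fun t => a * z t i k + b * w t i k)); last first.
    by apply/funext => t; rewrite !mxE.
  by apply: measurable_funD; apply: measurable_funM.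
- move=> t i j k tT; have [fp fa] := f0 t i j k tT.
  have [gp ga] := g0 t i j k tT; rewrite !mxE; split; first exact: nonneg.
  by move=> nadj; rewrite fa // ga // !mulr0 addr0.
- move=> i k; have := solves_lincomb a b (mbx i k) (mby i k).
  congr (solves _ _ _ _); apply/funext => t; first by rewrite !mxE.
  have -> : \sum_j (a *: f t k + b *: g t k) j i =
      a * (\sum_j f t k j i) + b * (\sum_j g t k j i).
    by rewrite !mulr_sumr -big_split; apply: eq_bigr => j _; rewrite !mxE.
  (* The inflow is common to both solutions and [a + b = 1]. *)
  by rewrite !mxE -[X in _ = X + _ - _]mul1r -ab; lra.
- move=> t tT; have [zd fs fR] := Cx t tT; have [wd gs gR] := Cy t tT.
  split=> [i k|i|i j k adj].
  + have [x0 _] := xz0 t i k tT; have [y0 _] := yw0 t i k tT.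
    rewrite !mxE.
    have conc := demand_concave N i k.
    apply: le_trans (concave_function_lincomb conc _ _ a0 b0 ab).
    * by apply: lerD; apply: ler_wpM2l.
    * by rewrite /= in_itv /= x0.
    * by rewrite /= in_itv /= y0.
  + rewrite occupancy_lincomb.
    have conc := supply_concave N i.
    apply: le_trans (concave_function_lincomb conc _ _ a0 b0 ab).
    * have -> : \sum_k \sum_j (a *: f t k + b *: g t k) j i =
          a * (\sum_k \sum_j f t k j i) + b * (\sum_k \sum_j g t k j i).
        rewrite !mulr_sumr -big_split; apply: eq_bigr => k _ /=.
        rewrite !mulr_sumr -big_split; apply: eq_bigr => j _ /=.
        by rewrite !mxE.
      by apply: lerD; apply: ler_wpM2l.
    * rewrite /= in_itv /= andbT; apply: occupancy_ge0 => k.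
      by have [] := xz0 t i k tT.
    * rewrite /= in_itv /= andbT; apply: occupancy_ge0 => k.
      by have [] := yw0 t i k tT.
  + by rewrite !mxE fR // gR //; lra.
- by rewrite xinit yinit -scalerDl ab scale1r.
Qed.

Lemma convex_feasible2 c T :
  convex_set (feasible2 N c T : set (convex_lmodType _)).
Proof.
move=> [[x z] f] [[y w] g] l; rewrite !inE => P Q.
apply: (feasible2_lincomb _ _ _ P Q) => //; last exact: unstable.add_onemK.
by apply: unstable.onem_ge0.
Qed.

End convexity.

(** * Monotonicity of the cost *)

(** By convexity the difference quotients of [f] from [p] in the direction
    [q - p] at steps in [(0, 1]] are at most [f q - f p]; the directional
    derivative is their limit. *)
Lemma convex_function_gradient_le (R : realType) (V : normedModType R)
    (D : set (convex_lmodType V)) (f : V -> R) (p q : V) :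
    convex_function D f -> D p -> D q -> differentiable f p ->
  'D_(q - p) f p <= f q - f p.
Proof.
move=> cf Dp Dq df.
have : derivable f p (q - p) by exact: diff_derivable.
move=> /cvg_ex[l Hl].
have -> : 'D_(q - p) f p = l by apply: cvg_lim Hl.
have Hr := cvg_dnbhs_at_right Hl.
apply: (cvgr_to_le Hr); near=> h.
have h0 : 0 < h by near: h; exact: nbhs_right_gt.
have h1 : h <= 1 by near: h; apply: nbhs_right_le.
have h01 : Itv.spec (@Itv.num_sem R) (Itv.Real `[0, 1]%Z) h.
  by rewrite /= /Itv.num_sem /= ger0_real ?(ltW h0) // in_itv /= h1 ltW.
have := cf (Itv.mk h01) q p (mem_set Dq) (mem_set Dp).
have -> : (q : convex_lmodType V) <| Itv.mk h01 |> p = h *: (q - p) + p.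
  have -> : (q : convex_lmodType V) <| Itv.mk h01 |> p =
    h *: q + (1 - h) *: p by [].
  by rewrite scalerBl scale1r scalerBr addrAC -addrA addrCA addrC.
rewrite convRE /= /unstable.onem => conv_le.
rewrite /= -[_ *: _]/(_ * _) ler_pdivrMl //.
rewrite /shift /=; lra.
Unshelve. all: by end_near.
Qed.

Section orthant_gradient.
Context {R : realType} {n m : nat}.
Implicit Type phi : 'M[R]_(n, m) * 'M[R]_(n, m) -> R.

Lemma derive_coordinates phi p (u w : 'M[R]_(n, m)) : differentiable phi p ->
  'D_(u, w) phi p = \sum_i \sum_k
    (u i k * 'D_(delta_mx i k, 0) phi p + w i k * 'D_(0, delta_mx i k) phi p).
Proof.
move=> dphi; rewrite deriveE //.
have -> : (u, w) = \sum_i \sum_k (u i k *: (delta_mx i k, 0 : 'M[R]_(n, m)) +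
    w i k *: (0 : 'M[R]_(n, m), delta_mx i k)).
  rewrite [LHS]surjective_pairing /= [X in (X, _)]matrix_sum_delta.
  rewrite [X in (_, X)]matrix_sum_delta [RHS]surjective_pairing.
  rewrite !raddf_sum /=; congr (_, _); apply: eq_bigr => i _.
    by rewrite raddf_sum /=; apply: eq_bigr => k _ /=; rewrite scaler0 addr0.
  by rewrite raddf_sum /=; apply: eq_bigr => k _ /=; rewrite scaler0 add0r.
rewrite linear_sum; apply: eq_bigr => i _; rewrite linear_sum.
by apply: eq_bigr => k _; rewrite linearD !linearZ !deriveE.
Qed.

(** In the gradient inequality at [p], each coordinate of [q - p] has the sign
    of the corresponding partial derivative, so every term is nonnegative. *)
Lemma admissible_cost_monotone phi p q : admissible_cost phi ->
    orthant p -> orthant q -> (forall i k, p.1 i k <= q.1 i k) ->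
    (forall i k, q.2 i k <= p.2 i k) -> phi p <= phi q.
Proof.
move=> [cphi dphi dx dz _] op oq pq1 qp2; rewrite -subr_ge0.
apply: le_trans (convex_function_gradient_le cphi op oq (dphi p op)).
case: p q op oq pq1 qp2 => [x z] [y w] op oq pq1 qp2 /=.
have -> : (y, w) - (x, z) = (y - x, w - z) by [].
rewrite derive_coordinates; last exact: dphi.
apply: sumr_ge0 => i _; apply: sumr_ge0 => k _; rewrite !mxE addr_ge0 //.
  by rewrite mulr_ge0 ?subr_ge0 ?pq1 // dx.
by rewrite mulr_le0 ?subr_le0 ?qp2 // dz.
Qed.

End orthant_gradient.

(** * Measurability of the cost along a trajectory *)

Section measurability.
Context {d : measure_display} {X : measurableType d} {R : realType}.

(** Any subset of a countable type is a countable union of points, so that the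
    preimage of any set under [g \o q] is a countable union of fibres. *)
Lemma measurable_fun_countable (C : countType) (D : set X) (q : X -> C)
    (g : C -> R) : measurable D ->
    (forall c, measurable (D `&` q @^-1` [set c])) ->
  measurable_fun D (g \o q).
Proof.
move=> mD mq _ Y mY.
have -> : D `&` (g \o q) @^-1` Y =
    \bigcup_(c in g @^-1` Y) (D `&` q @^-1` [set c]).
  apply/seteqP; split=> t /=; first by move=> [Dt Yt]; exists (q t).
  by move=> [c Yc [Dt ->]].
rewrite bigcup_mkcond; apply: countable_bigcupT_measurable => [|c].
  exact: countableP.
by case: ifP.
Qed.

Lemma measurable_fun_floor_fiber (D : set X) (f : X -> R) (r : R) (a : int) :
    measurable_fun D f -> measurable D ->
  measurable (D `&` [set t | Num.floor (r * f t) = a]).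
Proof.
move=> mf mD.
have mrf : measurable_fun D (fun t => r * f t) by apply: measurable_funM.
have := mrf mD `[a%:~R, (a + 1)%:~R[%classic (measurable_itv _).
congr (measurable _); congr (_ `&` _); apply/seteqP; split=> t /=;
  rewrite in_itv /=; first by move/floor_def.
by move=> <-; exact: floor_itv.
Qed.

(** Continuity at the points of the curve does not make preimages of open sets
    under [phi] open, so the curve is rounded to the grid of step [1 / (N + 1)].
    The rounded curve has countable range and measurable fibres, and the values
    of [phi] along it tend to [phi (u t, v t)] by continuity at that point. *)
Lemma measurable_fun_comp_matrix (n m : nat) (D : set X)
    (phi : 'M[R]_(n, m) * 'M[R]_(n, m) -> R) (u v : X -> 'M[R]_(n, m)) :
    measurable D ->
    (forall i k, measurable_fun D (fun t => u t i k)) ->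
    (forall i k, measurable_fun D (fun t => v t i k)) ->
    (forall t, D t -> {for (u t, v t), continuous phi}) ->
  measurable_fun D (fun t => phi (u t, v t)).
Proof.
move=> mD mu mv cphi.
pose grid (N : nat) (A : 'M[R]_(n, m)) : 'M[int]_(n, m) :=
  map_mx (fun r => Num.floor (N.+1%:R * r)) A.
pose node (N : nat) (A : 'M[int]_(n, m)) : 'M[R]_(n, m) :=
  map_mx (fun a => N.+1%:R^-1 * a%:~R) A.
have node_cvg (A : 'M[R]_(n, m)) : node N (grid N A) @[N --> \oo] --> A.
  apply/cvg_ballP => e e0.
  have [N0 _ HN0] := near_infty_natSinv_lt (PosNum e0).
  exists N0 => // N NN0 /=; split=> // i k; rewrite !mxE /ball /=.
  have N1 : 0 < N.+1%:R :> R by [].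
  have /andP[lo hi] := floor_itv (N.+1%:R * A i k).
  have -> : A i k = N.+1%:R^-1 * (N.+1%:R * A i k) by rewrite mulKf // gt_eqF.
  rewrite -mulrBr normrM mulVKf ?gt_eqF // gtr0_norm ?invr_gt0 //.
  apply: le_lt_trans (HN0 N NN0).
  rewrite ler_piMr ?invr_ge0 // ger0_norm ?subr_ge0 //.
  by move: hi; rewrite intrD /=; lra.
pose approx (N : nat) := (fun c => phi (node N c.1, node N c.2)) \o
  (fun t => (grid N (u t), grid N (v t))).
apply: (@measurable_fun_cvg _ _ _ _ approx) => [N|t Dt].
  apply: measurable_fun_countable => // -[a b].
  (* The last [D] keeps the right-hand side inside [D] when the matrices have
     no entries. *)
  rewrite (_ : _ `&` _ = (\bigcap_(ik in [set: 'I_n * 'I_m])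
     (D `&` [set t | Num.floor (N.+1%:R * u t ik.1 ik.2) = a ik.1 ik.2])) `&`
     ((\bigcap_(ik in [set: 'I_n * 'I_m])
     (D `&` [set t | Num.floor (N.+1%:R * v t ik.1 ik.2) = b ik.1 ik.2])) `&`
     D)).
    apply: measurableI; last apply: measurableI => //.
      apply: fin_bigcap_measurable => // ik _.
      exact: measurable_fun_floor_fiber.
    apply: fin_bigcap_measurable => // ik _.
    exact: measurable_fun_floor_fiber.
  apply/seteqP; split => t /=.
    move=> [Dt [<- <-]]; split; first by move=> ik _; rewrite mxE.
    by split => // ik _; rewrite mxE.
  move=> [Ha [Hb Dt]]; split => //; congr (_, _);
    apply/matrixP => i k; rewrite mxE.
    by have [_ /=] := Ha (i, k) I.
  by have [_ /=] := Hb (i, k) I.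
have node_pair : (node N (grid N (u t)), node N (grid N (v t))) @[N --> \oo]
    --> (u t, v t) by exact: cvg_pair (node_cvg _) (node_cvg _).
exact: cvg_comp node_pair (cphi t Dt).
Qed.

End measurability.

(** * Integrability and convexity of the objective *)

Section cost.
Context {R : realType} {n m : nat} (N : network R n m).
Context (phi : 'M[R]_(n, m) * 'M[R]_(n, m) -> R) (hphi : admissible_cost phi).
Context (c : solution_concept) (T : R) (T0 : 0 < T).

Lemma feasible2_orthant p t :
  feasible2 N c T p -> 0 <= t <= T -> orthant (p.1.1 t, p.1.2 t).
Proof. by case: p => [[x z] f] [[xz0 _] _ _ _ _] tT i k; exact: xz0. Qed.

Lemma feasible2_state_continuous x z f i k : feasible2 N c T (x, z, f) ->
  {within `[0, T], continuous (fun t => x t i k)}.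
Proof. by move=> [_ _ mb _ _]; exact: solves_continuous (mb i k). Qed.

Lemma feasible2_state_bounded x z f : feasible2 N c T (x, z, f) ->
  exists B : 'M[R]_(n, m), forall t i k, 0 <= t <= T -> x t i k <= B i k.
Proof.
move=> fp.
have tmax (ik : 'I_n * 'I_m) :
    exists s, forall t, 0 <= t <= T -> x t ik.1 ik.2 <= x s ik.1 ik.2.
  have [s _ smax] := EVT_max (ltW T0)
    (feasible2_state_continuous (i := ik.1) (k := ik.2) fp).
  by exists s => t tT; apply: smax; rewrite in_itv.
have [s smax] := fin_all_exists tmax.
exists (\matrix_(i, k) x (s (i, k)) i k) => t i k tT; rewrite mxE.
exact: (smax (i, k)).
Qed.

Lemma running_cost_measurable p :
  feasible2 N c T p -> measurable_fun `[0, T] (running_cost phi p).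
Proof.
move=> fp; have orth t := feasible2_orthant (t := t) fp.
case: p fp orth => [[x z] f] fp orth; have [[_ mz] _ _ _ _] := fp.
apply: measurable_fun_comp_matrix => // [i k|t tT].
  apply: subspace_continuous_measurable_fun => //.
  exact: feasible2_state_continuous fp.
have [_ dphi _ _ _] := hphi; apply: differentiable_continuous; apply: dphi.
by apply: orth; move: tT; rewrite /= in_itv.
Qed.

(** With [B] an upper bound of the state and [Z] the demand at [B], which
    bounds the outflow, monotonicity traps the cost between [phi (0, Z)] and
    [phi (B, 0)]. *)
Lemma running_cost_bounded p :
  feasible2 N c T p -> [bounded running_cost phi p t | t in `[0, T]%classic].
Proof.
move=> fp; have orth t := feasible2_orthant (t := t) fp.
case: p fp orth => [[x z] f] fp orth; have [B xB] := feasible2_state_bounded fp.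
have [[xz0 _] _ _ Cx _] := fp.
have B0 i k : 0 <= B i k.
  have tT : 0 <= (0 : R) <= T by apply/andP; split=> //; exact: ltW.
  by have [x0 _] := xz0 0 i k tT; apply: le_trans (xB 0 i k tT).
pose Z : 'M[R]_(n, m) := \matrix_(i, k) demand N i k (B i k).
have Z0 i k : 0 <= Z i k by rewrite mxE demand_ge0.
have oB : orthant (B, 0 : 'M[R]_(n, m)) by move=> i k; rewrite /= mxE.
have oZ : orthant (0 : 'M[R]_(n, m), Z).
  by move=> i k; rewrite /= [X in 0 <= X]mxE.
exists (`|phi (B, 0)| + `|phi (0, Z)|); split; first exact: num_real.
move=> r Mr t; rewrite /= in_itv /= => tT; apply/ltW; apply: le_lt_trans Mr.
have [zd _ _] := Cx t tT.
have hi : phi (x t, z t) <= phi (B, 0).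
  apply: admissible_cost_monotone => //; first exact: orth.
    by move=> i k; exact: xB.
  by move=> i k /=; rewrite mxE; have [] := xz0 t i k tT.
have lo : phi (0, Z) <= phi (x t, z t).
  apply: admissible_cost_monotone => //; first exact: orth.
    by move=> i k /=; rewrite mxE; have [] := xz0 t i k tT.
  move=> i k /=; rewrite mxE; have [x0 _] := xz0 t i k tT.
  by apply: le_trans (zd i k) _; apply: demand_nondecreasing => //; exact: xB.
rewrite ler_norml /running_cost /=.
have := ler_norm (phi (B, 0)); have := lerNnormlW (lexx `|phi (0, Z)|).
have := normr_ge0 (phi (B, 0)); have := normr_ge0 (phi (0, Z)).
by move=> *; apply/andP; split; lra.
Qed.

Lemma running_cost_integrable p : feasible2 N c T p ->
  (@lebesgue_measure R).-integrable `[0, T] (EFin \o running_cost phi p).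
Proof.
move=> fp; apply: measurable_bounded_integrable => //.
- exact: compact_finite_measure (@segment_compact R 0 T).
- exact: running_cost_measurable.
- exact: running_cost_bounded.
Qed.

Lemma convex_total_cost :
  convex_function (feasible2 N c T : set (convex_lmodType _))
    (total_cost phi T).
Proof.
move=> l p q; rewrite !inE => fp fq.
have fpq : feasible2 N c T (p <| l |> q).
  by have := @convex_feasible2 _ _ _ N c T p q l; rewrite !inE; apply.
have Ip := running_cost_integrable fp; have Iq := running_cost_integrable fq.
have Il (r : R) g : (@lebesgue_measure R).-integrable `[0, T] (EFin \o g) ->
    (@lebesgue_measure R).-integrable `[0, T] (EFin \o (fun t => r * g t)).
  move=> Ig; rewrite (_ : _ \o _ = fun t => (r%:E * (EFin \o g) t)%E) //.
  exact: integrableZl Ig.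
rewrite convRE /total_cost -!RintegralZl // -RintegralD //; try exact: Il.
apply: le_Rintegral => //; first exact: running_cost_integrable.
  exact: integrableD (Il _ _ Ip) (Il _ _ Iq).
move=> t; rewrite /= in_itv /= => tT.
have [cphi _ _ _ _] := hphi.
have oq := feasible2_orthant fq tT.
exact: cphi (mem_set (feasible2_orthant fp tT)) (mem_set oq).
Qed.

End cost.

Theorem proposition1 (R : realType) (n m : nat) (N : network R n m)
    (phi : 'M[R]_(n, m) * 'M[R]_(n, m) -> R) (hphi : admissible_cost phi)
    (T : R) (hT : 0 < T) (c : solution_concept) :
  (forall a : R -> 'M[R]_(n, m), feasible1 N c T a `<=` feasible2 N c T) /\
  [/\ convex_set (feasible2 N c T : set (convex_lmodType _)),
      (forall p, feasible2 N c T p ->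
         (@lebesgue_measure R).-integrable `[0, T] (EFin \o running_cost phi p))
    & convex_function (feasible2 N c T : set (convex_lmodType _))
        (total_cost phi T)].
Proof.
split; first by move=> a; exact: feasible1_sub_feasible2.
split=> [|p fp|].
- exact: convex_feasible2.
- exact: running_cost_integrable fp.
- exact: convex_total_cost.
Qed.
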